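(* Let $\mathcal{G}=(V,E)$ be an infinite graph of finite degree. Then $\mathcal{G}$ possesses a unary automatic presentation if and only if there exist finite graphs $\mathcal{D}=(V_{\mathcal{D}},E_{\mathcal{D}})$ and $\mathcal{F}=(V_{\mathcal{F}},E_{\mathcal{F}})$ and mappings $\eta:V_{\mathcal{D}}\to P(V_{\mathcal{F}})$ and $\sigma:V_{\mathcal{F}}\to P(V_{\mathcal{F}})$ such that $\mathcal{G}$ is isomorphic to $\mathcal{G}_{\eta\sigma^\omega}$.
   Context: Graphs are undirected: edge sets are symmetric binary relations, and edges listed below are understood as undirected edges. $P(X)$ is the power set of $X$. A graph is of finite degree if there are only finitely many edges from each vertex. Unary automatic presentation: let $\diamond$ be a symbol different from $1$. The convolution $\otimes(1^m,1^n)$ is the word of length $\max(m,n)$ over $\{1,\diamond\}^2$ whose $k$-th letter is $(a,b)$, where $a=1$ if $k\le m$ and $a=\diamond$ otherwise, and $b=1$ if $k\le n$ and $b=\diamond$ otherwise. A relation $E'\subseteq 1^\star\times1^\star$ is regular if the set of convolutions of its pairs is the language of a finite automaton. A graph has a unary automatic presentation if it is isomorphic to a graph $(1^\star,E')$ with $E'$ regular. Unfolding: given finite graphs $\mathcal{D},\mathcal{F}$ and maps $\eta:V_{\mathcal{D}}\to P(V_{\mathcal{F}})$, $\sigma:V_{\mathcal{F}}\to P(V_{\mathcal{F}})$, the graph $\mathcal{G}_{\eta\sigma^\omega}$ has vertex set $V_{\mathcal{D}}\cup\{(v,i)\mid v\in V_{\mathcal{F}},\ i\in\omega\}$ (disjoint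 union) and edge set $$E_{\mathcal{D}}\cup\{(d,(v,0))\mid v\in\eta(d)\}\cup\{((v,i),(v',i))\mid (v,v')\in E_{\mathcal{F}},\ i\in\omega\}\cup\{((v,i),(v',i+1))\mid v'\in\sigma(v),\ i\in\omega\}.$$ *)

(* Defs.v *)
From mathcomp Require Import all_boot.
From mathcomp Require Import classical_sets cardinality.

Set Implicit Arguments.
Unset Strict Implicit.
Unset Printing Implicit Defensive.

(* Loops are allowed: the edge set is an arbitrary symmetric relation. *)
Record graph := Graph {
  vertex :> Type;
  edge : vertex -> vertex -> Prop;
  edge_sym : forall x y, edge x y -> edge y x
}.

Record fin_graph := FinGraph {
  fin_vertex :> finType;
  fin_edge : rel fin_vertex;
  fin_edge_sym : symmetric fin_edge
}.

Definition infinite_graph (G : graph) : Prop :=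
  infinite_set [set: vertex G]%classic.

Definition finite_degree (G : graph) : Prop :=
  forall x : G, finite_set [set y : vertex G | edge x y]%classic.

Definition isomorphic (G H : graph) : Prop :=
  exists f : G -> H,
    bijective f /\ forall x y : G, edge x y <-> edge (f x) (f y).

Record automaton (A : Type) := Automaton {
  state : finType;
  init : state;
  step : state -> A -> state;
  final : pred state
}.

Definition accepts (A : Type) (M : automaton A) (w : seq A) : bool :=
  final (foldl (@step A M) (init M) w).

(* [1^m] is the word [nseq m tt]. *)
Definition unary_word := seq unit.

(* [Some tt] is the letter 1 and [None] the padding symbol: [onth u k] is     *)
(* [Some tt] when [k < size u] and [None] otherwise (positions start at 0).   *)
Definition convolution (u v : unary_word) : seq (option unit * option unit) :=
  mkseq (fun k => (onth u k, onth v k)) (maxn (size u) (size v)).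

Definition regular_relation (R : unary_word -> unary_word -> Prop) : Prop :=
  exists M : automaton (option unit * option unit),
    forall w, accepts M w <-> exists u v, R u v /\ w = convolution u v.

Definition has_unary_presentation (G : graph) : Prop :=
  exists (R : unary_word -> unary_word -> Prop)
         (R_sym : forall u v, R u v -> R v u),
    regular_relation R /\ isomorphic G (Graph R_sym).

Section Unfolding.
Variables (D F : fin_graph) (eta : D -> {set F}) (sigma : F -> {set F}).

Definition unfolding_vertex : Type := (D + F * nat)%type.

Definition unfolding_arc (x y : unfolding_vertex) : bool :=
  match x, y with
  | inl d, inl d' => fin_edge d d'
  | inl d, inr (v, i) => (i == 0) && (v \in eta d)
  | inr (v, i), inr (v', j) =>
      (j == i) && fin_edge v v' || (j == i.+1) && (v' \in sigma v)
  | inr _, inl _ => false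
  end.

Definition unfolding_edge (x y : unfolding_vertex) : Prop :=
  unfolding_arc x y || unfolding_arc y x.

Lemma unfolding_edge_sym x y : unfolding_edge x y -> unfolding_edge y x.
Proof. by rewrite /unfolding_edge orbC. Qed.

Definition unfolding : graph := Graph unfolding_edge_sym.

End Unfolding.

(* Main.v *)
(** Both properties say that, up to a relabelling of the vertices by natural
    numbers, adjacency is banded (neighbours are at bounded distance) and
    invariant under a common shift by some period [p] from some point [N] on.
    An automaton with [q] states reading a unary convolution eventually cycles,
    with a period dividing [q!]; finite degree excludes accepting cycles in the
    padded part, so neighbours are less than [q!] apart, and one takes [N = q]
    and [p = q!].  Conversely, a banded periodic adjacency is recognised with
    finitely many states, by remembering the shorter length modulo [p] beyond
    [N] and the difference of the lengths truncated at [p].  A banded periodic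
    graph is an unfolding with [D] the first [N] vertices and one copy of [F]
    for each later block of [p] consecutive vertices. *)

Require Import Defs.
From mathcomp Require Import all_boot.
From mathcomp Require Import classical_sets cardinality.
From mathcomp Require Import zify.

Set Implicit Arguments.
Unset Strict Implicit.
Unset Printing Implicit Defensive.

(** * Periodicity of iterated maps and of relations on the naturals *)

(** The orbit of [x] enters a cycle within [#|T|] steps, and the cycle length is at most [#|T|], so
    it divides the factorial. This gives one period valid for all [f] and [x]. *)
Lemma iter_fact_period (T : finType) (f : T -> T) (x : T) (k j : nat) :
  #|T| <= k -> iter (k + j * (#|T|)`!) f x = iter k f x.
Proof.
move=> le_Tk.
have /trajectP[i lt_i eq_i] := looping_order f x.
have le_order : order f x <= #|T| by apply: max_card.
have iter_shift n : i <= n -> iter (n + (order f x - i)) f x = iter n f x.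
  move=> le_in; rewrite -(subnK le_in) -addnA subnKC; last exact: ltnW.
  by rewrite !iterD eq_i.
have iter_mul c n : i <= n -> iter (n + c * (order f x - i)) f x = iter n f x.
  elim: c n => [|c IHc] n le_in; first by rewrite mul0n addn0.
  by rewrite mulSn addnA IHc ?iter_shift //; lia.
have /dvdnP[c ->] : order f x - i %| (#|T|)`! by apply: dvdn_fact; lia.
by rewrite mulnA iter_mul //; lia.
Qed.

(** A single [p] is both bandwidth and period. The bound is one-sided because the relations
    considered are symmetric. *)
Definition banded_periodic (N p : nat) (E : rel nat) : Prop :=
  [/\ 0 < p, forall m n, E m n -> n < m + p
    & forall m n, N <= m -> N <= n -> E (m + p) (n + p) = E m n].

Lemma banded_periodicM N p E k a b :
    banded_periodic N p E -> N <= a -> N <= b ->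
  E (a + k * p) (b + k * p) = E a b.
Proof.
move=> [_ _ periodic] le_a le_b; elim: k => [|k IHk]; first by rewrite !addn0.
by rewrite !mulSnr !addnA periodic ?IHk //; lia.
Qed.

(** * Convolutions of unary words and their recognition *)

Local Notation letter := (option unit * option unit)%type.
Local Notation both := (Some tt, Some tt).
Local Notation fst_only := (Some tt, None).
Local Notation snd_only := (None, Some tt).
Local Notation unary n := (nseq n tt).

Lemma nseq_size_unary (u : unary_word) : u = unary (size u).
Proof. by elim: u => [|[] u {1}->]. Qed.

Lemma onth_nseq_unary n k : onth (unary n) k = if k < n then Some tt else None.
Proof.
by elim: n k => [|n IHn] [|k] //=; rewrite IHn.
Qed.

(** Truncated subtraction leaves at most one of the two padded blocks nonempty. *)
Lemma convolution_unary m n :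
  convolution (unary m) (unary n) =
  nseq (minn m n) both ++ nseq (m - n) fst_only ++ nseq (n - m) snd_only.
Proof.
rewrite /convolution !size_nseq; apply: (@eq_from_nth _ both).
  rewrite size_mkseq !size_cat !size_nseq; lia.
move=> k; rewrite size_mkseq => lt_k.
rewrite nth_mkseq // !onth_nseq_unary !nth_cat !size_nseq !nth_nseq.
by repeat case: ifP => ?; rewrite ?if_same //; lia.
Qed.

(* The pair of lengths read so far; [None] once the word is no longer a prefix
   of a convolution. *)
Definition count_step (x : option (nat * nat)) (a : letter) :
    option (nat * nat) :=
  match x, a with
  | Some (m, n), (Some _, Some _) =>
      if m == n then Some (m.+1, n.+1) else None
  | Some (m, n), (Some _, None) => if n <= m then Some (m.+1, n) else None
  | Some (m, n), (None, Some _) => if m <= n then Some (m, n.+1) else None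
  | _, _ => None
  end.

Definition parse (w : seq letter) : option (nat * nat) :=
  foldl count_step (Some (0, 0)) w.

Lemma foldl_nseq (S A : Type) (f : S -> A -> S) a n x :
  foldl f x (nseq n a) = iter n (f^~ a) x.
Proof. by elim: n x => //= n IHn x; rewrite IHn -iterSr. Qed.

Lemma parse_convolution m n :
  parse (convolution (unary m) (unary n)) = Some (m, n).
Proof.
have iter_both k : iter k (count_step^~ both) (Some (0, 0)) = Some (k, k).
  by elim: k => //= k ->; rewrite /= eqxx.
have iter_fst k d :
    iter d (count_step^~ fst_only) (Some (k, k)) = Some (k + d, k).
  by elim: d => [|d /= ->]; rewrite ?addn0 //= leq_addr addnS.
have iter_snd k d :
    iter d (count_step^~ snd_only) (Some (k, k)) = Some (k, k + d).
  by elim: d => [|d /= ->]; rewrite ?addn0 //= leq_addr addnS.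
rewrite convolution_unary /parse !foldl_cat !foldl_nseq iter_both.
case: (leqP m n) => [le_mn | lt_nm].
  by rewrite (eqP le_mn) /= iter_snd subnKC.
by rewrite iter_fst (eqP (ltnW lt_nm)) /= subnKC // ltnW.
Qed.

Lemma rcons_nseq (T : Type) (a : T) n : rcons (nseq n a) a = nseq n.+1 a.
Proof. by elim: n => //= n ->. Qed.

(** Induction on the last letter: the guards of [count_step] admit a letter only when the longer
    word is again a convolution. *)
Lemma parse_sound w m n :
  parse w = Some (m, n) -> w = convolution (unary m) (unary n).
Proof.
elim/last_ind: w m n => [|w a IHw] m n; first by case=> <- <-.
rewrite /parse foldl_rcons -/(parse w).
case: (parse w) IHw => [[m' n']|] // /(_ _ _ erefl) ->.
case: a => [[[]|] [[]|]] //=; case: ifP => // cmp [<- <-];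
  rewrite !convolution_unary.
- move/eqP: cmp => ->; rewrite !subnn !minnn /= !cats0.
  exact: rcons_nseq.
- have ->: n' - m' = 0 by lia.
  have ->: n' - m'.+1 = 0 by lia.
  have ->: minn m'.+1 n' = minn m' n' by lia.
  by rewrite !cats0 rcons_cat rcons_nseq subSn.
- have ->: m' - n' = 0 by lia.
  have ->: m' - n'.+1 = 0 by lia.
  have ->: minn m' n'.+1 = minn m' n' by lia.
  by rewrite /= rcons_cat rcons_nseq subSn.
Qed.

Lemma convolution_inj (u v u' v' : unary_word) :
  convolution u v = convolution u' v' -> u = u' /\ v = v'.
Proof.
rewrite (nseq_size_unary u) (nseq_size_unary v).
rewrite (nseq_size_unary u') (nseq_size_unary v') => /(congr1 parse).
by rewrite !parse_convolution => -[-> ->].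
Qed.

(** * An automaton for a banded periodic relation *)

Section RegularOfBanded.
Variables (N p : nat) (E : rel nat).
Hypotheses (E_sym : symmetric E) (E_band : banded_periodic N p E).

Let red k := if k < N then k else N + (k - N) %% p.

(** The shorter length is reduced by [red] and the excess of the longer one is cut at [p], where
    adjacency is already excluded. *)
Let red_pair (x : nat * nat) :=
  let k := red (minn x.1 x.2) in
  (k + minn (x.1 - x.2) p, k + minn (x.2 - x.1) p).

Let p_gt0 : 0 < p. Proof. by case: E_band. Qed.

Let redS k : red (red k).+1 = red k.+1.
Proof.
rewrite /red; case: (ltnP k N) => // le_Nk.
rewrite (ltnNge (N + _).+1) (ltnNge k.+1).
have -> : N <= (N + (k - N) %% p).+1 by lia.
have -> : N <= k.+1 by lia.
rewrite /= -addnS addKn subSn //.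
by rewrite -[in LHS]addn1 modnDml addn1.
Qed.

(** [count_step] only compares the two lengths, and since [p] is positive the reduction preserves
    their order. *)
Let red_pair_step x a :
  omap red_pair (count_step (omap red_pair x) a) =
  omap red_pair (count_step x a).
Proof.
case: x => [[m n]|] //=.
have redK k : red (red k) = red k.
  rewrite /red; case: (ltnP k N) => [->|le] //.
  by rewrite ltnNge leq_addr /= addKn modn_mod.
case: a => [[[]|] [[]|]] //=; rewrite /red_pair /=.
- have -> : (red (minn m n) + minn (m - n) p == red (minn m n) + minn (n - m) p)
            = (m == n) by lia.
  case: eqP => // ->; rewrite /= /red_pair /=.
  by rewrite !(subnn, minnn, min0n, addn0) redS.
- have -> : (red (minn m n) + minn (n - m) p <= red (minn m n) + minn (m - n) p)
            = (n <= m) by lia.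
  case: ifP => //= le; rewrite /red_pair /=.
  have -> : n - m = 0 by lia.
  have -> : n - m.+1 = 0 by lia.
  rewrite !min0n addn0.
  have -> : minn m n = n by lia.
  have -> : minn m.+1 n = n by lia.
  have -> : minn (red n + minn (m - n) p).+1 (red n) = red n by lia.
  by rewrite redK; congr (Some (_, _)); lia.
- have -> : (red (minn m n) + minn (m - n) p <= red (minn m n) + minn (n - m) p)
            = (m <= n) by lia.
  case: ifP => //= le; rewrite /red_pair /=.
  have -> : m - n = 0 by lia.
  have -> : m - n.+1 = 0 by lia.
  rewrite !min0n addn0.
  have -> : minn m n = m by lia.
  have -> : minn m n.+1 = m by lia.
  have -> : minn (red m) (red m + minn (n - m) p).+1 = red m by lia.
  by rewrite redK; congr (Some (_, _)); lia.
Qed.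

Let E_red_pair m n : E (red_pair (m, n)).1 (red_pair (m, n)).2 = E m n.
Proof.
have [_ band _] := E_band.
have E_far a b : (a + p <= b) || (b + p <= a) -> E a b = false.
  move=> far; apply/negbTE/negP => Eab.
  have := band _ _ Eab; rewrite E_sym in Eab; have := band _ _ Eab; lia.
(* A cut difference equals [p], so far pairs stay outside the band; near pairs keep their exact
   difference. *)
have [far|near] := boolP ((m + p <= n) || (n + p <= m)).
  by rewrite (E_far m n) // E_far //=; lia.
rewrite /red_pair /=; set k := minn m n.
have -> : minn (m - n) p = m - k by lia.
have -> : minn (n - m) p = n - k by lia.
have [le_km le_kn] : k <= m /\ k <= n by rewrite /k; lia.
rewrite /red; case: ltnP => [|le_Nk]; first by rewrite !subnKC.
(* This restores the [(k - N) %/ p] periods removed by [red]. *)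
rewrite -(banded_periodicM ((k - N) %/ p) E_band); [|lia|lia].
have := divn_eq (k - N) p => eq_k.
by congr (E _ _); lia.
Qed.

(** A reduced length is below [N + p] and the cut difference adds at most [p], so [inord] never
    takes its default value below. *)
Let K := N + p + p.

Let state_of (x : option (nat * nat)) : option ('I_K.+1 * 'I_K.+1) :=
  omap (fun y => (inord (red_pair y).1, inord (red_pair y).2)) x.

Let pair_of (s : option ('I_K.+1 * 'I_K.+1)) : option (nat * nat) :=
  omap (fun y => (val y.1, val y.2)) s.

Let pair_of_state_of x : pair_of (state_of x) = omap red_pair x.
Proof.
case: x => [[m n]|] //=.
have red_lt k : red k < N + p.
  by rewrite /red; case: (ltnP k N) => [|_]; [lia | rewrite ltn_add2l ltn_pmod].
have := red_lt (minn m n) => lt.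
by rewrite !inordK //= /K; lia.
Qed.

Let band_automaton : automaton letter :=
  Automaton (state_of (Some (0, 0)))
    (fun s a => state_of (count_step (pair_of s) a))
    (fun s => if pair_of s is Some (m, n) then E m n else false).

Let state_of_red x y :
  omap red_pair x = omap red_pair y -> state_of x = state_of y.
Proof. by case: x y => [x|] [y|] //= [eq1 eq2]; rewrite eq1 eq2. Qed.

Lemma regular_of_banded : regular_relation (fun u v => E (size u) (size v)).
Proof.
exists band_automaton => w.
have run x : foldl (@step _ band_automaton) (state_of x) w =
             state_of (foldl count_step x w).
  elim: w x => //= a w IHw x; rewrite -IHw; congr foldl.
  by apply: state_of_red; rewrite pair_of_state_of red_pair_step.
have -> : accepts band_automaton w =
          if parse w is Some (m, n) then E m n else false.
  rewrite /accepts run /= pair_of_state_of -/(parse w).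
  by case: (parse w) => [[m n]|] //=; rewrite -[RHS]E_red_pair.
split=> [|[u [v [Euv ->]]]].
  case parse_w: (parse w) => [[m n]|] // Emn.
  by exists (unary m), (unary n); rewrite !size_nseq (parse_sound parse_w).
by rewrite (nseq_size_unary u) (nseq_size_unary v) parse_convolution.
Qed.

End RegularOfBanded.

(** * From an automaton to a banded periodic relation *)

Section BandedOfRegular.
Variables (M : automaton letter).

Let E m n := accepts M (convolution (unary m) (unary n)).

Lemma banded_of_regular :
    (forall m n, E m n -> E n m) ->
    (forall m, finite_set [set n | E m n]%classic) ->
  banded_periodic #|state M| (#|state M|)`! E.
Proof.
move=> E_imp E_fin; set q := #|state M|.
have E_sym m n : E m n = E n m by apply/idP/idP; apply: E_imp.
(* For ordered lengths the run iterates two fixed maps in turn, so the period lemma applies to each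
   phase. *)
have E_le m n : m <= n ->
    E m n = final (iter (n - m) ((@step _ M)^~ snd_only)
                     (iter m ((@step _ M)^~ both) (init M))).
  move=> le_mn; rewrite /E /accepts convolution_unary !foldl_cat !foldl_nseq.
  by rewrite (eqP le_mn) (minn_idPl le_mn).
split=> [|m n Emn|m n].
- exact: fact_gt0.
- (* A neighbour [n] far from [m] would give the neighbours [n + k * q!]. *)
  rewrite ltnNge; apply/negP => far.
  (* Hence a gap of at least the factorial also exceeds the preperiod bound [q]. *)
  have q_fact : q <= q`! by case: (q) => // k; rewrite factS leq_pmulr ?fact_gt0.
  apply: infinite_nat.
  apply: (sub_finite_set _ (finite_preimage (f := fun k => n + k * q`!) _ (E_fin m))).
    move=> k _ /=; move: Emn; rewrite !E_le; [|lia|lia].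
    have -> : n + k * q`! - m = n - m + k * q`! by lia.
    by rewrite iter_fact_period // -/q; lia.
  by move=> i j _ _ /=; have := fact_gt0 q; nia.
wlog le_mn : m n / m <= n.
  case: (leqP m n) => [|/ltnW] le wl le1 le2; first exact: wl.
  by rewrite E_sym wl // E_sym.
(* A common shift lengthens only the first phase, which already has at least [q] steps. *)
move=> le_qm _; rewrite !E_le ?leq_add2r // subnDr.
by rewrite -{1}[q`!]mul1n iter_fact_period.
Qed.

End BandedOfRegular.

(** * Numbering the vertices of an unfolding *)

Section Coding.
Variables (D F : finType).

(** The copies of [F] fill consecutive blocks after [D], so moving to the next copy is adding
    [#|F|]. *)
Definition vertex_code (x : D + F * nat) : nat :=
  match x with
  | inl d => enum_rank d
  | inr (v, i) => #|D| + (i * #|F| + enum_rank v)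
  end.

Lemma vertex_code_inl d : vertex_code (inl d) < #|D|.
Proof. exact: ltn_ord. Qed.

Lemma vertex_code_inr v i :
  #|D| + i * #|F| <= vertex_code (inr (v, i)) < #|D| + i.+1 * #|F|.
Proof.
by rewrite leq_add2l leq_addr ltn_add2l mulSn [X in _ < X]addnC ltn_add2l ltn_ord.
Qed.

Lemma vertex_code_shift v i j :
  vertex_code (inr (v, i + j)) = vertex_code (inr (v, i)) + j * #|F|.
Proof. by rewrite /= mulnDl; lia. Qed.

Lemma vertex_code_bij : 0 < #|F| -> bijective vertex_code.
Proof.
move=> F_gt0; case: (pickP F) => [v0 _|F0]; last by rewrite (eq_card0 F0) in F_gt0.
pose decode k : D + F * nat :=
  if insub k is Some r then inl (enum_val (r : 'I_#|D|))
  else inr (nth v0 (enum F) ((k - #|D|) %% #|F|), (k - #|D|) %/ #|F|).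
exists decode => [[d|[v i]]|k]; rewrite /decode.
- rewrite /= insubT //= => lt_d; congr inl; apply: enum_rank_inj; apply: val_inj.
  by rewrite enum_valK.
- rewrite /= insubF; last by rewrite ltnNge leq_addr.
  rewrite addKn modnMDl modn_small // divnMDl // divn_small // addn0.
  by rewrite nth_enum_rank.
case: insubP => [r _ <-|]; first by rewrite /= enum_valK.
rewrite -leqNgt /= => le_k.
set v := nth _ _ _; have -> : enum_rank v = (k - #|D|) %% #|F| :> nat.
  have lt : (k - #|D|) %% #|F| < #|F| by rewrite ltn_pmod.
  have -> : v = enum_val (Ordinal lt) by rewrite /v (enum_val_nth v0).
  by rewrite enum_valK.
by rewrite -divn_eq subnKC.
Qed.

End Coding.

(** * Unfoldings and banded periodic relations *)

Lemma unfolding_banded (D F : fin_graph) (eta : D -> {set F})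
    (sigma : F -> {set F}) (decode : nat -> D + F * nat) :
    0 < #|F| -> cancel (@vertex_code D F) decode ->
    cancel decode (@vertex_code D F) ->
  exists N p, banded_periodic N p (fun m n =>
    unfolding_arc eta sigma (decode m) (decode n) ||
    unfolding_arc eta sigma (decode n) (decode m)).
Proof.
(* The period is a multiple of [#|F|], so it shifts by whole copies, and it is at least
   [#|D| + 2 * #|F|], which bounds the length of every edge. *)
move=> F_gt0 codeK decodeK; exists #|D|, (#|D|.+2 * #|F|); split=> [|m n|m n].
- by rewrite muln_gt0.
- have le_p : #|D| + (#|F| + #|F|) <= #|D|.+2 * #|F|.
    by have := leq_pmulr #|D| F_gt0; rewrite !mulSn; lia.
  case: (decode m) (decodeK m) => [d|[v i]] <-;
    case: (decode n) (decodeK n) => [d'|[w j]] <-; rewrite /unfolding_arc.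
  + by move=> _; have := vertex_code_inl F d'; lia.
  + rewrite orbF => /andP[/eqP-> _].
    by have /andP[_] := vertex_code_inr D w 0; rewrite mul1n; lia.
  + move=> _; have := vertex_code_inl F d'.
    by have /andP[+ _] := vertex_code_inr D v i; lia.
  + move=> adj; have : j <= i.+1 by lia.
    rewrite -(leq_pmul2r F_gt0) mulSn.
    have /andP[_] := vertex_code_inr D w j; rewrite mulSn.
    by have /andP[+ _] := vertex_code_inr D v i; lia.
move=> le_m le_n.
have shift k : #|D| <= k -> exists v i,
    decode k = inr (v, i) /\ decode (k + #|D|.+2 * #|F|) = inr (v, i + #|D|.+2).
  case: (decode k) (decodeK k) => [d|[v i]] <-.
    by rewrite leqNgt vertex_code_inl.
  by move=> _; exists v, i; rewrite -vertex_code_shift codeK.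
have [v [i [-> ->]]] := shift m le_m; have [w [j [-> ->]]] := shift n le_n.
by rewrite /unfolding_arc -!addSn !eqn_add2r.
Qed.

(** [eta] and [sigma] are read off from [E] between [D] and copy 0 and between copies 0 and 1;
    periodicity transports this to all copies, and the band forbids longer edges. *)
Lemma banded_unfolding (N p : nat) (E : rel nat) :
  symmetric E -> banded_periodic N p E ->
  exists (D F : fin_graph) (eta : D -> {set F}) (sigma : F -> {set F}),
    0 < #|F| /\ forall x y : unfolding eta sigma,
      edge x y <-> E (vertex_code x) (vertex_code y).
Proof.
move=> E_sym E_band; have [p_gt0 band _] := E_band.
pose code := @vertex_code 'I_N 'I_p.
have D_sym : symmetric (fun d d' => E (code (inl d)) (code (inl d'))).
  by move=> d d'; apply: E_sym.
have F_sym : symmetric (fun v v' => E (code (inr (v, 0))) (code (inr (v', 0)))).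
  by move=> v v'; apply: E_sym.
exists (FinGraph D_sym), (FinGraph F_sym).
exists (fun d => [set v | E (code (inl d)) (code (inr (v, 0)))]).
exists (fun v => [set v' | E (code (inr (v, 0))) (code (inr (v', 1)))]).
split=> [|x y]; first by rewrite /= card_ord.
have code_inl d : code (inl d) < N.
  by have := vertex_code_inl 'I_p d; rewrite card_ord.
have code_inr v i : N + i * p <= code (inr (v, i)) < N + i.+1 * p.
  by have := vertex_code_inr 'I_N v i; rewrite !card_ord.
have shift v w i j k :
    E (code (inr (v, i + k))) (code (inr (w, j + k))) =
    E (code (inr (v, i))) (code (inr (w, j))).
  rewrite /code !vertex_code_shift card_ord (banded_periodicM k E_band) //.
    by have /andP[+ _] := code_inr v i; apply: leq_trans; apply: leq_addr.
  by have /andP[+ _] := code_inr w j; apply: leq_trans; apply: leq_addr.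
(* Vertices two or more blocks apart lie at distance at least [p]. *)
have far v w i j : i.+1 < j -> E (code (inr (v, i))) (code (inr (w, j))) = false.
  move=> lt_ij; apply/negbTE/negP => /band.
  have /andP[_] := code_inr v i; have /andP[+ _] := code_inr w j.
  by move: lt_ij; rewrite -(leq_pmul2r p_gt0) !mulSn; lia.
(* Arcs never go back to [D] or to an earlier copy, so they are [E] restricted to this
   orientation. *)
have arcE (x' y' : 'I_N + 'I_p * nat) : unfolding_arc
    (D := FinGraph D_sym) (F := FinGraph F_sym)
    (fun d => [set v | E (code (inl d)) (code (inr (v, 0)))])
    (fun v => [set v' | E (code (inr (v, 0))) (code (inr (v', 1)))]) x' y' =
    E (code x') (code y') &&
    match x', y' with
    | inr _, inl _ => false
    | inr (_, i), inr (_, j) => i <= j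
    | _, _ => true
    end.
  case: x' y' => [d|[v i]] [d'|[w j]]; rewrite /unfolding_arc ?andbT ?andbF ?inE //.
    (* Copies of positive index start at [N + p] or later, beyond the band of any vertex of [D]. *)
    case: j => [|j] //; apply/esym/negbTE/negP => /band.
    have /andP[le_code _] := code_inr w j.+1.
    rewrite ltnNge (leq_trans _ le_code) // mulSn addnA.
    exact: leq_trans (leq_add (ltnW (code_inl d)) (leqnn p)) (leq_addr _ _).
  case: (ltngtP i j) => [lt_ij|lt_ji|<-].
  - rewrite /= andbT; case: (ltngtP i.+1 j) => [lt|lt|<-] /=.
    + exact/esym/far.
    + lia.
    + exact/esym/(shift v w 0 1 i).
  - by rewrite andbF ltn_eqF //; lia.
  - by rewrite ltn_eqF // orbF andbT; apply/esym/(shift v w 0 0 i).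
(* Any two vertices are oriented in at least one direction, so symmetrising the arcs recovers
   [E]. *)
rewrite /= /unfolding_edge !arcE (E_sym (code y)) -andb_orr.
split=> [/andP[] // | -> /=].
by case: x y => [d|[v i]] [d'|[w j]] //; apply: leq_total.
Qed.

Theorem theorem4p5 (G : graph) (G_infinite : infinite_graph G)
    (G_finite_degree : finite_degree G) :
  has_unary_presentation G <->
  exists (D F : fin_graph) (eta : D -> {set F}) (sigma : F -> {set F}),
    isomorphic G (unfolding eta sigma).
Proof.
split=> [[R [R_sym [[M M_R] [f [[g fK gK] f_edge]]]]] |
         [D [F [eta [sigma [f [[g fK gK] f_edge]]]]]]].
- pose E m n := accepts M (convolution (unary m) (unary n)).
  (* Injectivity of the convolution makes acceptance determine the pair of words. *)
  have ER u v : E (size u) (size v) <-> R u v.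
    rewrite /E -!nseq_size_unary M_R; split=> [|Ruv]; last by exists u, v.
    by case=> u' [v' [Ruv /convolution_inj[-> ->]]].
  have E_imp m n : E m n -> E n m.
    have := ER (unary m) (unary n); have := ER (unary n) (unary m).
    by rewrite !size_nseq => -> ->; apply: R_sym.
  have E_fin m : finite_set [set n | E m n]%classic.
    apply: (sub_finite_set _ (finite_preimage
      (f := fun n => g (unary n)) _ (G_finite_degree (g (unary m))))).
      by move=> n /= Emn; apply/f_edge; rewrite !gK /=; apply/ER; rewrite !size_nseq.
    by move=> i j _ _ /(can_inj gK)/(congr1 size); rewrite !size_nseq.
  have E_sym : symmetric E by move=> m n; apply/idP/idP; apply: E_imp.
  have [D [F [eta [sigma [F_gt0 unfold_edge]]]]] :=
    banded_unfolding E_sym (banded_of_regular E_imp E_fin).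
  exists D, F, eta, sigma.
  have [decode codeK decodeK] := vertex_code_bij D F_gt0.
  exists (decode \o size \o f); split.
    apply: bij_comp; last by exists g.
    apply: bij_comp; first by exists (@vertex_code D F).
    by exists (nseq^~ tt) => u; rewrite ?size_nseq // -nseq_size_unary.
  by move=> x y; rewrite f_edge unfold_edge /= !decodeK ER.
(* With [F] empty the unfolding would have only the finitely many vertices of [D]. *)
have F_gt0 : 0 < #|F|.
  rewrite lt0n; apply/negP => /eqP/card0_eq F0; apply: G_infinite.
  apply: (sub_finite_set _ (finite_image (fun d : D => g (inl d))
    (@finite_finset D setT))).
  move=> x _; case fx: (f x) => [d|[v i]]; last by have := F0 v.
  by exists d; rewrite /= ?inE // -fx fK.
have [decode codeK decodeK] := vertex_code_bij D F_gt0.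
have [N [p E_band]] := unfolding_banded eta sigma F_gt0 codeK decodeK.
set E : rel nat := fun m n => _ in E_band.
have E_sym : symmetric E by move=> m n; rewrite /E orbC.
have R_sym (u v : unary_word) : E (size u) (size v) -> E (size v) (size u).
  by rewrite E_sym.
exists (fun u v => E (size u) (size v)), R_sym.
split; first exact: regular_of_banded E_band.
exists (fun x => unary (vertex_code (f x))); split.
  exists (fun u => g (decode (size u))) => [x|u].
    by rewrite size_nseq codeK fK.
  by rewrite gK decodeK -nseq_size_unary.
by move=> x y; rewrite f_edge /= !size_nseq /E !codeK.
Qed.
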